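(* Let $m\ge 3$ be a natural number such that there is a prime strictly between $(m-1)^2$ and $m^2$ (so that $k_1$ is defined). Consider the following statements for this $m$: (L) there is a prime $p$ with $m^2<p<(m+1)^2$; (C) $m^2<\dfrac{D(m^4)}{p(k_1)}<(m+1)^2$; (W) $D(p(k_1)^2)\in H_{(m-1)^4,\,m^4}$; (S) $D(m^4)\in H_{(m-1)^4,\,m^4}$. Then: 1) (C) holds if and only if (S) holds; 2) (L) holds if and only if (W) holds; 3) (W) holds if and only if $m^2<\dfrac{D(p(k_1)^2)}{p(k_1)}<(m+1)^2$; 4) (S) implies (L); 5) (S) implies (W).
   Context: Let $p_i$ be the $i$-th prime ($p_1=2$). For $k\ge 1$ put $p(k)=p_{k+2}$, so $p(1)=5$, $p(2)=7$, etc. The $T$-matrix has entries $a(k;n)=p(k)\left(5+2\lfloor n/2\rfloor+4\lfloor (n-1)/2\rfloor\right)$, $k,n\ge 1$. An entry is called defining if it is not divisible by $5$ and is a product of two (not necessarily distinct) primes. For real $b\ge 49$, the upper defining element $D(b)$ is the smallest defining element greater than $b$ in row $\kappa$, where $\kappa>1$ is the index for which $p(\kappa)^2$ is the largest $p(k)^2$ ($k>1$) with $p(k)^2\le b$. For $m\ge 3$, $k_1$ is the index such that $p(k_1)$ is the largest $p(k)$ with $k>1$ and $(m-1)^2<p(k)<m^2$. For a defining element $a(k_1;n)>p(k_1)^2$ let $j$ be its transition row, i.e. the unique index with $k_1<j$, $a(k_1;n)<p(j)^2$, $a(j;r)=a(k_1;n)$ where $r$ is the column with $a(k_1;r)=p(k_1)^2$,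 and $a(j;n)=p(j)^2$ (such a unique $j$ exists, and $p(j)=a(k_1;n)/p(k_1)$). The active set $H_{(m-1)^4,\,m^4}$ is the set of all defining elements $a(k_1;n)>p(k_1)^2$ of row $k_1$ whose transition row $j$ satisfies either $a(k_1;n)<m^4<p(j)^2<(m+1)^4$ or $m^4<a(k_1;n)<p(j)^2<(m+1)^4$. *)

(* Defs.v *)
From mathcomp Require Import all_boot all_order all_algebra.
From mathcomp Require Import zify.
From mathcomp Require Import boolp classical_sets reals.

Set Implicit Arguments.
Unset Strict Implicit.
Unset Printing Implicit Defensive.

Import Order.TTheory GRing.Theory Num.Theory.

Lemma ex_next_prime (n : nat) : exists q, prime q && (n < q).
Proof. by case: (prime_above n) => q nq pq; exists q; rewrite pq. Qed.

Definition next_prime (n : nat) : nat := ex_minn (ex_next_prime n).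

(* The i-th prime for i >= 1 (nth_prime 1 = 2); nth_prime 0 = 0 is junk. *)
Definition nth_prime (i : nat) : nat := iter i next_prime 0.

(* p(k); meaningful for k >= 1, with p(1) = 5. *)
Definition pT (k : nat) : nat := nth_prime k.+2.

(* Entries of the T-matrix; rows and columns are indexed from 1. *)
Definition Tentry (k n : nat) : nat :=
  pT k * (5 + 2 * (n %/ 2) + 4 * ((n - 1) %/ 2)).

Definition defining (x : nat) : Prop :=
  ~~ (5 %| x) /\ exists q1 q2 : nat, [/\ prime q1, prime q2 & x = q1 * q2].

Definition defining_in_row (k x : nat) : Prop :=
  defining x /\ exists2 n : nat, 1 <= n & x = Tentry k n.

Section UpperDefiningElement.
Variable R : realType.
Implicit Type b : R.

Definition is_kappa b (k : nat) : Prop :=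
  [/\ 1 < k, (((pT k ^ 2)%:R : R) <= b)%R &
      forall k', 1 < k' -> (((pT k' ^ 2)%:R : R) <= b)%R ->
        pT k' ^ 2 <= pT k ^ 2].

Definition is_upper_defining b (x : nat) : Prop :=
  exists k : nat, is_kappa b k /\
    [/\ defining_in_row k x, (b < x%:R)%R &
        forall y, defining_in_row k y -> (b < y%:R)%R -> x <= y].

(* D(b); the default value 0 is only taken when b < 49, see
   [upper_definingP]. *)
Definition upper_defining b : nat := xget 0 [set x | is_upper_defining b x]%classic.

End UpperDefiningElement.

Definition is_k1 (m k : nat) : Prop :=
  [/\ 1 < k, (m - 1) ^ 2 < pT k < m ^ 2 &
      forall k', 1 < k' -> (m - 1) ^ 2 < pT k' < m ^ 2 -> pT k' <= pT k].

(* The default value 0 is only taken when k_1 is undefined, see [k1P]. *)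
Definition k1 (m : nat) : nat := xget 0 [set k | is_k1 m k]%classic.

(* j is the transition row of the entry in row k and column n. *)
Definition is_transition_row (k n j : nat) : Prop :=
  [/\ k < j,
      Tentry k n < pT j ^ 2,
      exists r : nat,
        [/\ 1 <= r, Tentry k r = pT k ^ 2 & Tentry j r = Tentry k n] &
      Tentry j n = pT j ^ 2].

(* H_{(m-1)^4, m^4}; a transition row exists and is unique by
   [transition_row_ex] and [transition_row_unique]. *)
Definition active_set (m : nat) : set nat :=
  [set x | exists n : nat,
    [/\ 1 <= n, x = Tentry (k1 m) n, defining x, pT (k1 m) ^ 2 < x &
        exists2 j : nat, is_transition_row (k1 m) n j &
          (x < m ^ 4 /\ m ^ 4 < pT j ^ 2 < m.+1 ^ 4)
          \/ (m ^ 4 < x /\ x < pT j ^ 2 < m.+1 ^ 4)]]%classic.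

(* Well-definedness of the notions above. *)

Lemma nth_primeS (i : nat) :
  [/\ prime (nth_prime i.+1), nth_prime i < nth_prime i.+1 &
      forall q, prime q -> nth_prime i < q -> nth_prime i.+1 <= q].
Proof.
rewrite /= /next_prime; case: ex_minnP => q /andP[pq lq] qmin; split => //.
by move=> r pr lr; apply: qmin; rewrite pr.
Qed.

(* Unfolding next_prime during unification triggers a costly search. *)
#[global] Opaque next_prime.

Lemma nth_prime_lt (i j : nat) : (nth_prime i < nth_prime j) = (i < j).
Proof.
apply: (leqW_mono (leq_mono _)) => {i j}.
by apply: homo_ltn; [exact: ltn_trans | move=> i; case: (nth_primeS i)].
Qed.

Lemma nth_prime_surj (q : nat) : prime q -> exists i, q = nth_prime i.+1.
Proof.
move=> pq.
have [i] : exists i, (q <= nth_prime i.+1).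
  exists q; elim: {pq} q => // q IH.
  by have [_ lt _] := nth_primeS q.+1; apply: leq_ltn_trans IH lt.
elim: i => [|i IH] le_q.
  exists 0; apply/eqP; rewrite eqn_leq le_q.
  by have [_ _ ->] := nth_primeS 0; rewrite ?prime_gt0.
have [/IH //|lt_q] := leqP q (nth_prime i.+1).
exists i.+1; apply/eqP; rewrite eqn_leq le_q.
by have [_ _ ->] := nth_primeS i.+1.
Qed.

Lemma nth_prime_small :
  [/\ nth_prime 1 = 2, nth_prime 2 = 3, nth_prime 3 = 5 & nth_prime 4 = 7].
Proof.
have step i q : prime q -> nth_prime i < q ->
    all (fun r => ~~ prime r) (iota (nth_prime i).+1 (q - (nth_prime i).+1)) ->
    nth_prime i.+1 = q.
  move=> pq lq /allP np; have [pi li imin] := nth_primeS i.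
  apply/eqP; rewrite eqn_leq imin // leqNgt; apply/negP => gt.
  have mi : nth_prime i.+1 \in iota (nth_prime i).+1 (q - (nth_prime i).+1).
    by rewrite mem_iota; lia.
  by have := np _ mi; rewrite pi.
have e1 : nth_prime 1 = 2 by apply: step.
have e2 : nth_prime 2 = 3 by apply: step; rewrite ?e1.
have e3 : nth_prime 3 = 5 by apply: step; rewrite ?e2.
by split=> //; apply: step; rewrite ?e3.
Qed.

Lemma pT1 : pT 1 = 5. Proof. by have [_ _ e _] := nth_prime_small. Qed.
Lemma pT2 : pT 2 = 7. Proof. by have [_ _ _ e] := nth_prime_small. Qed.

Lemma pT_prime (k : nat) : prime (pT k).
Proof. by case: (nth_primeS k.+1). Qed.

Lemma pT_lt (k j : nat) : (pT k < pT j) = (k < j).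
Proof. by rewrite /pT nth_prime_lt. Qed.

Lemma pT_le (k j : nat) : (pT k <= pT j) = (k <= j).
Proof. by rewrite leqNgt pT_lt -leqNgt. Qed.

Lemma pT_inj : injective pT.
Proof. by move=> k j e; apply/eqP; rewrite eqn_leq -(pT_le k) -(pT_le j) e leqnn. Qed.

Lemma pT_surj (q : nat) : prime q -> 5 <= q -> exists2 k, 1 <= k & q = pT k.
Proof.
move=> /nth_prime_surj[i ->] ge5; exists i.-1; last first.
  by move: ge5; case: i => //; case: nth_prime_small => ->.
move: ge5; case: nth_prime_small => _ _ <- _.
by rewrite leqNgt nth_prime_lt; lia.
Qed.

Lemma pT_gt_id (k : nat) : k < pT k.
Proof.
elim: k => [|k IH]; first exact: prime_gt0 (pT_prime 0).
by apply: leq_ltn_trans IH _; rewrite pT_lt.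
Qed.

Lemma col_surj (q : nat) : prime q -> 5 <= q ->
  exists2 n, 1 <= n & q = 5 + 2 * (n %/ 2) + 4 * ((n - 1) %/ 2).
Proof.
move=> pq ge5.
have n2 : ~~ (2 %| q) by rewrite dvdn_prime2 //; apply/eqP; lia.
have n3 : ~~ (3 %| q) by rewrite dvdn_prime2 //; apply/eqP; lia.
have [e|e] : q %% 6 = 1 \/ q %% 6 = 5 by lia.
  by exists (2 * (q %/ 6)); lia.
by exists (2 * (q %/ 6) + 1); lia.
Qed.

Lemma defining_pT (k q : nat) : 1 < k -> prime q -> 5 < q ->
  defining_in_row k (pT k * q).
Proof.
move=> k_gt1 pq q5; split; last first.
  by have [n n1 ->] := col_surj pq (ltnW q5); exists n.
split; last by exists (pT k), q; split=> //; exact: pT_prime.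
rewrite Euclid_dvdM // !dvdn_prime2 ?pT_prime // negb_or.
by rewrite -pT1 !(inj_eq pT_inj) pT1; lia.
Qed.

Lemma is_kappa_unique (R : realType) (b : R) (k k' : nat) :
  is_kappa b k -> is_kappa b k' -> k = k'.
Proof.
move=> [k1 kb kmax] [k1' kb' kmax'].
apply/eqP; rewrite eqn_leq -(pT_le k) -(pT_le k').
by have := kmax _ k1' kb'; have := kmax' _ k1 kb; rewrite !leq_exp2r // => -> ->.
Qed.

Lemma ex_kappa (R : realType) (b : R) : (49%:R <= b)%R ->
  exists k, is_kappa b k.
Proof.
move=> b49.
pose P k := (1 < k) && (((pT k ^ 2)%:R : R) <= b)%R.
have P2 : P 2 by rewrite /P pT2.
have bnd k : P k -> k <= Num.truncn b.
  move=> /andP[_ kb]; rewrite truncn_ge_nat; last exact: le_trans b49.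
  apply: le_trans kb; rewrite ler_nat.
  by have := pT_gt_id k; nia.
have [k /andP[k1 kb] kmax] := ex_maxnP (ex_intro _ 2 P2) bnd.
exists k; split=> // k' k1' kb'.
by rewrite leq_exp2r // pT_le kmax // /P k1'.
Qed.

Lemma is_upper_defining_unique (R : realType) (b : R) (x y : nat) :
  is_upper_defining b x -> is_upper_defining b y -> x = y.
Proof.
move=> [k [kk [xd bx xmin]]] [k' [kk' [yd bY ymin]]].
have e := is_kappa_unique kk kk'; subst k'.
by apply/eqP; rewrite eqn_leq xmin ?ymin.
Qed.

Lemma upper_definingP (R : realType) (b : R) : (49%:R <= b)%R ->
  is_upper_defining b (upper_defining b).
Proof.
move=> b49; apply: (@xgetPex _ 0 [set x | is_upper_defining b x]%classic).
have [k kk] := ex_kappa b49; have [k_gt1 _ _] := kk.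
pose P x := `[< defining_in_row k x >] && (b < x%:R)%R.
have exP : exists x, P x.
  have [q lq pq] := prime_above (Num.truncn b + 5).
  exists (pT k * q); apply/andP; split.
    by apply/asboolP/defining_pT => //; lia.
  apply: lt_le_trans (truncnS_gt b) _; rewrite ler_nat.
  apply: leq_trans (leq_pmull q (prime_gt0 (pT_prime k))).
  exact: leq_ltn_trans (leq_addr 5 _) lq.
have [x /andP[/asboolP xd bx] xmin] := ex_minnP exP.
exists x; exists k; split=> //; split=> // y yd bY.
by apply: xmin; rewrite /P bY andbT; apply/asboolP.
Qed.

Lemma k1P (m : nat) : 3 <= m ->
  (exists2 q, prime q & (m - 1) ^ 2 < q < m ^ 2) -> is_k1 m (k1 m).
Proof.
move=> m3 [q pq qm]; apply: (@xgetPex _ 0 [set k | is_k1 m k]%classic).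
pose P k := (1 < k) && ((m - 1) ^ 2 < pT k < m ^ 2).
have exP : exists k, P k.
  have [e|m4] : m = 3 \/ 4 <= m by lia.
    by exists 2; rewrite /P pT2 e.
  have q9 : 9 < q by nia.
  have [k k_gt0 e] := pT_surj pq (ltac:(lia)); exists k.
  by rewrite /P -e qm andbT -pT_lt pT1 -e; lia.
have bnd k : P k -> k <= m ^ 2.
  by move=> /and3P[_ _ lt]; have := pT_gt_id k; lia.
have [k /andP[kg km] kmax] := ex_maxnP exP bnd.
by exists k; split=> // k' kg' km'; rewrite pT_le kmax // /P kg'.
Qed.

Lemma transition_row_ex (k n : nat) : 1 < k ->
  defining (Tentry k n) -> pT k ^ 2 < Tentry k n ->
  exists j, is_transition_row k n j.
Proof.
move=> k_gt1 [_ [q1 [q2 [p1 p2 e]]]] gt.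
have pk := pT_prime k.
set c := 5 + 2 * (n %/ 2) + 4 * ((n - 1) %/ 2).
have Te : Tentry k n = pT k * c by [].
have c_gt : pT k < c by move: gt; rewrite Te; nia.
have pc : prime c.
  have : pT k %| q1 * q2 by rewrite -e Te dvdn_mulr.
  rewrite Euclid_dvdM // !dvdn_prime2 // => /orP[] /eqP ek.
    have -> : c = q2 by apply/eqP; rewrite -(eqn_pmul2l (prime_gt0 pk)) -Te e ek.
    by [].
  have -> : c = q1.
    by apply/eqP; rewrite -(eqn_pmul2l (prime_gt0 pk)) -Te e ek mulnC.
  by [].
have pk5 : 5 < pT k by rewrite -pT1 pT_lt.
have [j _ ej] := pT_surj pc (ltac:(lia)).
have [r r1 er] := col_surj pk (ltnW pk5).
exists j; rewrite /is_transition_row -pT_lt -ej; split=> //.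
- by rewrite Te; nia.
- exists r; split=> //; first by rewrite /Tentry -er; lia.
  by rewrite Te /Tentry -er -ej mulnC.
- by rewrite /Tentry -/c -ej; lia.
Qed.

Lemma transition_row_unique (k n j j' : nat) :
  is_transition_row k n j -> is_transition_row k n j' -> j = j'.
Proof.
have pk := prime_gt0 (pT_prime k).
have key i : is_transition_row k n i -> pT i * pT k = Tentry k n.
  move=> [_ _ [r [_ + <-]] _]; rewrite /Tentry -mulnn => /eqP.
  by rewrite eqn_pmul2l // => /eqP ->.
move=> /key ej /key ej'; apply/pT_inj/eqP.
by rewrite -(eqn_pmul2r pk) ej ej'.
Qed.

(* Main.v *)
Require Import Defs.
From mathcomp Require Import all_boot all_order all_algebra.
From mathcomp Require Import zify.
From mathcomp Require Import boolp classical_sets reals.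

(** Write [p1] for the largest prime below [m ^ 2].  In row [k1 m] the defining
elements above [p1 ^ 2] are exactly the products [p1 * q] with [q > p1] prime
([defining_in_row_factor], [defining_pT]), and the transition row of [p1 * q]
is the row of the prime [q] ([transition_row_factor]).  Since
[p1 < m ^ 2], both [p1 ^ 2] and [m ^ 4] select the row [k1 m], so each upper
defining element is [p1 * q] for the least prime [q] making the product exceed
the bound ([upper_defining_factor]).

Everything then becomes a statement about [q]: by [active_set_factor],
membership of [p1 * q] in the active set says that [m ^ 2 < q < m.+1 ^ 2], which
is also what the bounds on the quotient by [p1] say.  This settles (1) and (3).
For [p1 ^ 2] the prime [q] is the successor of [p1] among the primes; it is
larger than [m ^ 2], so it lies below [m.+1 ^ 2] as soon as some prime
does between these squares, which is (2).  For [m ^ 4], membership exhibits such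
a prime, which is (4); and (5) is (4) followed by (2). *)

Import GRing.Theory Num.Theory.

Lemma prime_neq_sqr (q a : nat) : prime q -> q != a ^ 2.
Proof.
move=> pq; apply/eqP => e; have := pq; rewrite e -mulnn => /primeP[gt1 dv].
by have /orP[] := dv a (dvdn_mulr a (dvdnn a)) => /eqP; nia.
Qed.

(** The entry is [pT k] times a column factor; unique factorization makes that
factor prime, and it exceeds [pT k] because the entry exceeds [pT k ^ 2]. *)
Lemma defining_in_row_factor (k x : nat) :
  defining_in_row k x -> pT k ^ 2 < x ->
  exists q, [/\ prime q, pT k < q & x = pT k * q].
Proof.
move=> [[_ [q1 [q2 [pq1 pq2 e]]]] [n _ en]] gt.
have pk := pT_prime k; have pk0 := prime_gt0 pk.
have pk_dvd : pT k %| q1 * q2 by rewrite -e en dvdn_mulr.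
have [q pq xq] : exists2 q, prime q & x = pT k * q.
  move: pk_dvd; rewrite Euclid_dvdM // !dvdn_prime2 // => /orP[] /eqP ek.
    by exists q2; rewrite // ek.
  by exists q1; rewrite // ek mulnC.
exists q; split=> //.
by move: gt; rewrite xq -mulnn ltn_pmul2l.
Qed.

Lemma transition_row_factor (k n j : nat) :
  is_transition_row k n j -> Tentry k n = pT k * pT j.
Proof.
move=> [_ _ [r [_ + <-]] _]; rewrite /Tentry -mulnn => /eqP.
by rewrite eqn_pmul2l ?prime_gt0 ?pT_prime // => /eqP ->; rewrite mulnC.
Qed.

Lemma upper_defining_factor (R : realType) (b k : nat) :
  is_kappa (b%:R : R)%R k ->
  exists q, [/\ prime q, pT k < q, upper_defining (b%:R : R)%R = pT k * q &
    forall q', prime q' -> b < pT k * q' -> q <= q'].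
Proof.
move=> kb; have [k_gt1 + _] := kb; rewrite ler_nat => le_b.
have pk5 : 5 < pT k by rewrite -pT1 pT_lt.
have pk7 : 7 <= pT k by rewrite -pT2 pT_le.
have b49 : ((49%:R : R) <= b%:R)%R by rewrite ler_nat; nia.
have [k' [kb' [xd + xmin]]] := upper_definingP b49.
have ek := is_kappa_unique kb' kb; subst k'.
rewrite ltr_nat => gt_b.
have [q [pq lt_q e]] := defining_in_row_factor _ _ xd (leq_ltn_trans le_b gt_b).
exists q; split=> // q' pq' lt_b.
have lt_q' : pT k < q' by nia.
have := xmin _ (defining_pT k_gt1 pq' (ltn_trans pk5 lt_q')).
by rewrite ltr_nat e leq_pmul2l ?prime_gt0 ?pT_prime //; apply.
Qed.

(** The two alternatives in the active set differ by the side of [m ^ 4] on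
which [p1 * q] lies, where [p1] is the prime of row [k1 m], and each amounts to
[m ^ 4 < q ^ 2 < m.+1 ^ 4].  Equality [p1 * q = m ^ 4] would make
[p1] a divisor of [m], which is impossible as [m < p1]. *)
Lemma active_set_factor (m q : nat) : 0 < m -> 1 < k1 m -> m < pT (k1 m) ->
  prime q -> pT (k1 m) < q ->
  active_set m (pT (k1 m) * q) <-> m ^ 2 < q < m.+1 ^ 2.
Proof.
move=> m_gt0; set k := k1 m => k_gt1 lt_m pq lt_q.
have pk := pT_prime k; have pk0 := prime_gt0 pk.
have sqr_between : (m ^ 4 < q ^ 2 < m.+1 ^ 4) = (m ^ 2 < q < m.+1 ^ 2).
  by rewrite (expnM m 2 2) (expnM m.+1 2 2) !ltn_exp2r.
have row_prime n j : pT k * q = Tentry k n -> is_transition_row k n j ->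
    pT j = q.
  move=> e /transition_row_factor; rewrite -e => /eqP.
  by rewrite eqn_pmul2l // => /eqP.
have lt_sqr : pT k * q < q ^ 2 by rewrite -mulnn ltn_pmul2r ?prime_gt0.
have sqr_lt : pT k ^ 2 < pT k * q by rewrite -mulnn ltn_pmul2l.
have neq : pT k * q != m ^ 4.
  apply/eqP => e; have : pT k %| m ^ 4 by rewrite -e dvdn_mulr.
  by rewrite Euclid_dvdX // andbT => /(dvdn_leq m_gt0); lia.
rewrite -sqr_between; split.
  move=> [n [_ e _ _ [j /(row_prime _ _ e) -> [[_ //]|[lt1 /andP[lt2 lt3]]]]]].
  by rewrite lt3 (ltn_trans lt1 lt2).
move=> /andP[lt1 lt2].
have pk5 : 5 < pT k by rewrite -pT1 pT_lt.
have [df [n n1 e]] := defining_pT k_gt1 pq (ltn_trans pk5 lt_q).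
have [j tr] : exists j, is_transition_row k n j.
  by apply: transition_row_ex; rewrite -?e.
exists n; split=> //; exists j => //; rewrite (row_prime _ _ e tr).
have [lt|gt|/eqP] := ltngtP (pT k * q) (m ^ 4); last by rewrite (negPf neq).
  by left; rewrite lt1 lt2.
by right; rewrite lt_sqr lt2.
Qed.

Lemma quotient_between (R : realType) (p q a b : nat) : 0 < p ->
  ((a%:R < ((p * q)%:R / p%:R : R) < b%:R)%R) = (a < q < b).
Proof.
move=> p_gt0; rewrite mulnC natrM mulfK ?pnatr_eq0 -?lt0n //.
by rewrite !ltr_nat.
Qed.

(** A prime between [p1] and [m ^ 2] would contradict the choice of [p1] as the
largest one below [m ^ 2]. *)
Lemma k1_next_prime (m k q : nat) :
  is_k1 m k -> prime q -> pT k < q -> m ^ 2 < q.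
Proof.
move=> [k_gt1 /andP[gt_k lt_k] kmax] pq lt_q.
rewrite ltn_neqAle eq_sym prime_neq_sqr //= leqNgt; apply/negP => lt_m.
have pk5 : 5 < pT k by rewrite -pT1 pT_lt.
have [k' _ e] := pT_surj pq (ltnW (ltn_trans pk5 lt_q)).
have k'_gt1 : 1 < k' by rewrite -pT_lt pT1 -e (ltn_trans pk5).
have := kmax k' k'_gt1; rewrite -e lt_m (ltn_trans gt_k lt_q) => /(_ isT).
by rewrite leqNgt lt_q.
Qed.

Lemma k1_is_kappa (R : realType) (m k b : nat) :
  is_k1 m k -> pT k ^ 2 <= b <= m ^ 4 -> is_kappa (b%:R : R)%R k.
Proof.
move=> k1k /andP[ge_b le_b]; have [k_gt1 _ _] := k1k.
split=> // [|k' _]; rewrite ler_nat // => le'.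
rewrite leq_exp2r // leqNgt; apply/negP => lt.
have := k1_next_prime _ _ _ k1k (pT_prime k') lt.
have := leq_trans le' le_b; rewrite (expnM m 2 2) leq_exp2r //.
by rewrite leqNgt => /negPf ->.
Qed.

Theorem mainTheorem3 (R : realType) (m : nat) (hm : 3 <= m)
    (hprime : exists2 q : nat, prime q & (m - 1) ^ 2 < q < m ^ 2) :
  let p1 := pT (k1 m) in
  let Dm := upper_defining ((m ^ 4)%:R : R)%R in
  let Dp := upper_defining ((p1 ^ 2)%:R : R)%R in
  let L := exists2 p : nat, prime p & m ^ 2 < p < m.+1 ^ 2 in
  let C := ((m ^ 2)%:R < (Dm%:R / p1%:R : R) < (m.+1 ^ 2)%:R)%R in
  let W := active_set m Dp in
  let S := active_set m Dm in
  [/\ C <-> S,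
      L <-> W,
      W <-> ((m ^ 2)%:R < (Dp%:R / p1%:R : R) < (m.+1 ^ 2)%:R)%R,
      S -> L &
      S -> W].
Proof.
move=> p1 Dm Dp L C W S.
have k1k := k1P hm hprime; have [k_gt1 /andP[gt_p1 lt_p1] _] := k1k.
have p1_gt0 : 0 < p1 by rewrite prime_gt0 ?pT_prime.
have m_gt0 : 0 < m by lia.
have lt_m : m < p1 by rewrite /p1; nia.
have sqr_le : p1 ^ 2 <= m ^ 4 by rewrite (expnM m 2 2) leq_exp2r // ltnW.
have [|qm [pqm lt_qm eDm _]] := @upper_defining_factor R (m ^ 4) (k1 m).
  by apply: k1_is_kappa _ _ _ _ k1k _; rewrite sqr_le leqnn.
have [|qp [pqp lt_qp eDp qp_min]] := @upper_defining_factor R (p1 ^ 2) (k1 m).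
  by apply: k1_is_kappa _ _ _ _ k1k _; rewrite leqnn sqr_le.
have SE : S <-> m ^ 2 < qm < m.+1 ^ 2.
  by rewrite /S /Dm eDm; apply: active_set_factor.
have WE : W <-> m ^ 2 < qp < m.+1 ^ 2.
  by rewrite /W /Dp eDp; apply: active_set_factor.
have SL : S -> L by move=> /SE ?; exists qm.
have LW : L <-> W.
  split=> [[p pp /andP[gt_p lt_p]]|/WE ?]; last by exists qp.
  apply/WE; rewrite (k1_next_prime _ _ _ k1k pqp lt_qp) /=.
  apply: leq_ltn_trans lt_p; apply: qp_min => //.
  by rewrite -mulnn ltn_pmul2l // (ltn_trans lt_p1).
split=> //.
- by rewrite /C /Dm eDm quotient_between //; apply: iff_sym.
- by rewrite /Dp eDp quotient_between.
- by move=> /SL /LW.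
Qed.
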